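(* Let $\Omega\subset\mathbb{R}^4$ be a smooth bounded uniformly convex domain and let $u\in C^\infty(\overline\Omega)$ be the unique smooth admissible solution of $\sigma_3(D^2u)=1$ in $\Omega$, $u=0$ on $\partial\Omega$, $D^2u\in\Gamma_3$ in $\Omega$. Suppose that the set $\{q\in\Omega: u(q)<-\tfrac{3}{125}\}$ is not convex. If $\Psi$ is a real-valued function that is strictly increasing on the range of $u$, then $\Psi\circ u$ is not convex in $\Omega$. In particular, $-(-u)^\alpha$ is not convex for any $\alpha>0$.
   Context: For a real symmetric matrix $A$ with eigenvalues $\mu_1,\dots,\mu_n$, $\sigma_k(A)=\sum_{i_1<\dots<i_k}\mu_{i_1}\cdots\mu_{i_k}$, and $\Gamma_3=\{A:\sigma_1(A)>0,\ \sigma_2(A)>0,\ \sigma_3(A)>0\}$. A bounded smooth domain is uniformly convex if all principal curvatures of its boundary are bounded below by a positive constant. Such a solution satisfies $u<0$ in $\Omega$. *)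

(* Defs.v *)
From HB Require Import structures.
From mathcomp Require Import all_boot all_order all_algebra.
From mathcomp Require Import all_classical all_reals all_analysis.

Set Implicit Arguments.
Unset Strict Implicit.
Unset Printing Implicit Defensive.

Import Order.TTheory GRing.Theory Num.Theory.
Import numFieldNormedType.Exports.

Local Open Scope classical_set_scope.
Local Open Scope ring_scope.

Section Spectrum.
Variables (R : realType) (n : nat).
Implicit Type A : 'M[R]_n.

(* The eigenvalues of A listed with algebraic multiplicity, in an arbitrary
   order. The list exists whenever A is symmetric; the zero row is a junk value
   taken when the characteristic polynomial does not split over R. *)
Definition eigenvalues A : 'rV[R]_n :=
  xget 0 [set mu : 'rV[R]_n | char_poly A = \prod_(i < n) ('X - (mu 0 i)%:P)].

Definition sigma (k : nat) A : R :=
  \sum_(I : {set 'I_n} | #|I| == k) \prod_(i in I) eigenvalues A 0 i.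

Definition Gamma3 : set 'M[R]_n :=
  [set A | [/\ A^T = A, 0 < sigma 1 A, 0 < sigma 2 A & 0 < sigma 3 A]].

End Spectrum.

Section Smoothness.
Variables (R : realType) (n : nat).
Implicit Types (f u : 'rV[R]_n -> R) (U Omega : set 'rV[R]_n).

Definition unit_vec (i : 'I_n) : 'rV[R]_n := delta_mx 0 i.

(* partials [:: i1; ...; ik] f = d_{i1} ( ... (d_{ik} f)). *)
Definition partials (s : seq 'I_n) f : 'rV[R]_n -> R :=
  foldr (fun i g => fun x => 'D_(unit_vec i) g x) f s.

Definition grad f (x : 'rV[R]_n) : 'rV[R]_n := \row_i partials [:: i] f x.

Definition hessian f (x : 'rV[R]_n) : 'M[R]_n :=
  \matrix_(i, j) partials [:: i; j] f x.

Definition smooth_on U f : Prop :=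
  forall (s : seq 'I_n) (x : 'rV[R]_n), U x ->
    {for x, continuous (partials s f)} /\
    (forall i : 'I_n, derivable (partials s f) x (unit_vec i)).

(* C^oo up to the boundary: f is smooth in Omega, continuous on its closure,
   and every partial derivative extends continuously to the closure. The values
   of f outside the closure are irrelevant. *)
Definition smooth_up_to_boundary Omega f : Prop :=
  [/\ smooth_on Omega f,
      {within closure Omega, continuous f} &
      forall s : seq 'I_n, exists2 g : 'rV[R]_n -> R,
        {within closure Omega, continuous g} &
        forall x, Omega x -> g x = partials s f x].

End Smoothness.

Section Domains.
Variables (R : realType) (n : nat).
Implicit Types (Omega U : set 'rV[R]_n) (p v : 'rV[R]_n) (rho : 'rV[R]_n -> R).

(* The library norm on row vectors is the sup norm. *)
Definition dot (v w : 'rV[R]_n) : R := \sum_(i < n) v 0 i * w 0 i.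

Definition euclid_norm v : R := Num.sqrt (dot v v).

Definition boundary Omega : set 'rV[R]_n := closure Omega `\` interior Omega.

Definition domain Omega : Prop := [/\ open Omega, connected Omega & Omega !=set0].

Definition local_defining_function Omega p U rho : Prop :=
  [/\ open U, U p, smooth_on U rho,
      (forall x, U x -> grad rho x != 0) &
      (forall x, U x -> (Omega x <-> rho x < 0))].

Definition smooth_boundary Omega : Prop :=
  forall p, boundary Omega p -> exists U rho, local_defining_function Omega p U rho.

(* The gradient of a defining function points out of Omega. *)
Definition outer_normal rho (x : 'rV[R]_n) : 'rV[R]_n :=
  (euclid_norm (grad rho x))^-1 *: grad rho x.

(* The principal curvatures at p are the eigenvalues of the Weingarten map
   v |-> D_v nu(p) on the tangent space, nu being the outer unit normal field
   of a defining function. The map does not depend on the defining function,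
   and its sign is such that spheres of radius r bounding a ball have principal
   curvatures 1/r. *)
Definition principal_curvature Omega p (kappa : R) : Prop :=
  exists U rho, local_defining_function Omega p U rho /\
    exists v, [/\ v != 0, dot v (outer_normal rho p) = 0 &
                  'D_v (outer_normal rho) p = kappa *: v].

Definition uniformly_convex Omega : Prop :=
  exists2 kappa0 : R, 0 < kappa0 &
    forall p kappa, boundary Omega p -> principal_curvature Omega p kappa ->
      kappa0 <= kappa.

Definition admissible_solution Omega (u : 'rV[R]_n -> R) : Prop :=
  [/\ smooth_up_to_boundary Omega u,
      (forall x, Omega x -> sigma 3 (hessian u x) = 1),
      (forall x, boundary Omega x -> u x = 0) &
      (forall x, Omega x -> Gamma3 (hessian u x))].

End Domains.

(* Main.v *)
Require Import Defs.
From HB Require Import structures.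
From mathcomp Require Import all_boot all_order all_algebra.
From mathcomp Require Import all_classical all_reals all_analysis.
From mathcomp Require Import ring lra.

Import Order.TTheory GRing.Theory Num.Theory.
Import numFieldNormedType.Exports.

Local Open Scope classical_set_scope.
Local Open Scope ring_scope.

Set Implicit Arguments.
Unset Strict Implicit.
Unset Printing Implicit Defensive.

(** Suppose that Psi o u is convex on Omega. When Omega itself is convex, the
    sublevel set of u at any level c is convex: at a point z of a segment
    [x, y] with u x < c and u y < c, the value Psi (u z) is at most a convex
    combination of Psi (u x) and Psi (u y), hence at most one of them, and a
    strictly increasing Psi reflects this to u z < c. This contradicts the
    hypothesis at the level -3/125. The powers are the case
    Psi s = - (- s) ^ alpha, which is strictly increasing on the negative
    numbers. Two geometric facts remain.

    Convexity of Omega. Convexity of a function is an inequality whose middle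
    point is not required to lie in Omega, so one needs to know that it does;
    that is, positive principal curvatures have to force convexity
    ([uniformly_convex_segment]). Fix x in Omega and let B be the set of y such
    that [x, y] lies in Omega. It contains x, and it is open since segments are
    compact. It is closed in Omega: if y in Omega is a limit of points of B,
    then [x, y] lies in the closure of Omega, and should it meet the boundary
    at z, a defining function rho at z restricted to the segment has a local
    maximum at z. Then y - x is tangent at z and the Hessian of rho is
    nonpositive on it, whereas positive curvature makes it positive
    ([boundary_hessian_pos]). As Omega is connected, B is all of Omega.
    The curvatures are given as eigenvalues of the Weingarten map, so the last
    step minimizes the Rayleigh quotient of the Hessian on the tangent space: a
    minimizer is an eigenvector ([constrained_eigenvector]), and the
    derivative of the normal field along it ([derive_outer_normal]) shows that
    the minimum is, up to the factor |grad rho|, a principal curvature.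

    Negativity of u. On Gamma_3 the trace of the Hessian is positive, so u has
    no interior maximum ([no_interior_max]); its maximum over the compact
    closure is on the boundary, where u = 0.

    Both facts use second derivatives in an arbitrary direction, whereas
    smoothness is expressed by iterated partial derivatives. The first part
    passes from one to the other: continuous partial derivatives give all
    directional derivatives ([is_derive_partials]), and mixed partial
    derivatives commute ([derive_comm]). *)

(** * Directional derivatives and the symmetry of second derivatives *)

Section DirectionalDerivatives.
Context {R : realType} {V : normedModType R}.
Implicit Types (f : V -> R) (x y v w a : V).

(** The form of the derivative that suits additive estimates: no quotient, and
    h = 0 needs no special treatment. *)
Lemma is_deriveP f x v (d : R) : is_derive x v f d <->
  forall e : R, 0 < e -> \forall h \near (0 : R),
    `|f (h *: v + x) - f x - h * d| <= e * `|h|.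
Proof.
have E (h : R) (e : R) : h != 0 ->
    (`|d - h^-1 *: (f (h *: v + x) - f x)| <= e) =
    (`|f (h *: v + x) - f x - h * d| <= e * `|h|).
  move=> h0; rewrite -ler_pdivrMr ?normr_gt0// -normfV -normrM distrC.
  by rewrite mulrBl [h * d]mulrC mulfK// [_ / h]mulrC.
split=> [[dfx dE] e e0|H].
  have /cvgrPdist_le/(_ e e0) : (fun h : R => h^-1 *: (f (h *: v + x) - f x))
    @ 0^' --> d by rewrite -dE; exact: dfx.
  rewrite near_withinE; apply: filterS => h.
  have [->|h0 /(_ isT)] := eqVneq h 0; last by rewrite E.
  by rewrite scale0r add0r subrr mul0r subrr normr0 mulr0.
have fxd : (fun h : R => h^-1 *: (f (h *: v + x) - f x)) @ 0^' --> d.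
  apply/cvgrPdist_le => e e0; rewrite near_withinE.
  by apply: filterS (H e e0) => h He h0; rewrite E.
by apply: DeriveDef; [apply/cvg_ex; exists d|exact/cvg_lim].
Qed.

Lemma is_derive_line f x v (t : R) : derivable f (t *: v + x) v ->
  is_derive t 1 (fun s => f (s *: v + x)) ('D_v f (t *: v + x)).
Proof.
have E : (fun h : R => h^-1 *: (f (h *: v + (t *: v + x)) - f (t *: v + x))) =
  (fun h : R => h^-1 *: (f ((h *: 1 + t) *: v + x) - f (t *: v + x))).
  by apply/funext => h; rewrite scalerDl addrA [h *: 1]mulr1.
move=> df; apply: DeriveDef; first by move: df; rewrite /derivable /= E.
by rewrite /derive /= E.
Qed.

Lemma is_derive_scale_dir f x v (c d : R) :
  is_derive x v f d -> is_derive x (c *: v) f (c * d).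
Proof.
move=> /is_deriveP fxv; apply/is_deriveP => e e0.
have c0 : 0 < `|c| + 1 by rewrite ltr_wpDl.
have : (fun h : R => h * c) @ 0 --> (0 : R).
  by rewrite -{2}(mul0r c); exact: mulrr_continuous.
have He := fxv _ (divr_gt0 e0 c0).
move=> /(_ _ He); rewrite nbhs_simpl/=; apply: filterS => h /=.
rewrite scalerA mulrA => /le_trans; apply.
rewrite normrM mulrA [_ * `|c|]mulrC mulrA ler_wpM2r// mulrC -mulrA ger_pMr//.
by rewrite mulrC ler_pdivrMr ?mul1r ?lerDl.
Qed.

Lemma mean_value_dir f x v :
  (forall t : R, 0 <= t <= 1 -> derivable f (t *: v + x) v) ->
  exists2 t : R, 0 < t < 1 & f (v + x) - f x = 'D_v f (t *: v + x).
Proof.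
move=> df.
have [||t] := @MVT R (fun s => f (s *: v + x)) (fun t => 'D_v f (t *: v + x))
  _ _ ltr01.
- move=> t; rewrite in_itv/= => /andP[t0 t1]; apply: is_derive_line.
  by apply: df; rewrite !ltW.
- apply: derivable_within_continuous => t; rewrite in_itv/= => t01.
  by have /is_derive_line[] := df _ t01.
rewrite in_itv/= scale1r scale0r add0r subr0 mulr1 => t01 ->.
by exists t.
Qed.

(** One scalar h bounds both coordinates, so that all the intermediate points that
    the mean value theorem may return are covered at once. *)
Lemma near_parallelogram (P : V -> Prop) x v w : (\forall y \near x, P y) ->
  \forall h \near (0 : R), forall s t : R, `|s| <= `|h| -> `|t| <= `|h| ->
    P (s *: v + (t *: w + x)).
Proof.
move=> /nbhs_ballP[r /= r0 xP].
have d0 : 0 < `|v| + `|w| + 1 by rewrite ltr_wpDl// addr_ge0.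
have := @nbhs0_lt R R^o _ (divr_gt0 r0 d0).
apply: filterS => h hr s t sh th; apply: xP.
rewrite -ball_normE /= addrA opprD addrCA subrr addr0 normrN.
rewrite (le_lt_trans (ler_normD _ _))// !normrZ.
rewrite ltr_pdivlMr// in hr; apply: le_lt_trans hr.
by rewrite !mulrDr mulr1 -addrA lerD ?ler_wpM2r// ler_wpDr ?ler_wpM2r.
Qed.

Lemma near_line (P : V -> Prop) x v : (\forall y \near x, P y) ->
  \forall h \near (0 : R), P (h *: v + x).
Proof.
move=> /(near_parallelogram v 0); apply: filterS => h Hh.
by have := Hh _ _ (lexx _) (lexx _); rewrite scaler0 add0r.
Qed.

Lemma derive_scale_dir f x v (c : R) : derivable f x v ->
  'D_(c *: v) f x = c * 'D_v f x.
Proof. by move=> /derivableP/(is_derive_scale_dir c)[]. Qed.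

Lemma derivable_scale_dir f x v (c : R) : derivable f x v ->
  derivable f x (c *: v).
Proof. by move=> /derivableP/(is_derive_scale_dir c)[]. Qed.

(** The increment along c v + w is the increment along w followed by the one along
    c v from the displaced point; the mean value theorem turns the latter into a
    value of D_v f near x, and continuity of D_v f at x is then enough. Adding
    coordinate directions one at a time yields every direction. *)
Lemma is_derive_add_dir f x v w (c a : R) :
  (\forall y \near x, derivable f y v) -> {for x, continuous ('D_v f)} ->
  is_derive x w f a -> is_derive x (c *: v + w) f (c * 'D_v f x + a).
Proof.
move=> df cDf /is_deriveP fw; apply/is_deriveP => e e0.
have c0 : 0 < `|c| + 1 by rewrite ltr_wpDl.
have e20 : 0 < e / 2 by rewrite divr_gt0.
have ec0 : 0 < e / 2 / (`|c| + 1) by rewrite divr_gt0.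
have D' : \forall y \near x, `|'D_v f x - 'D_v f y| <= e / 2 / (`|c| + 1).
  by move/cvgrPdist_le : cDf; apply.
have dD' : \forall y \near x, derivable f y v /\
    `|'D_v f x - 'D_v f y| <= e / 2 / (`|c| + 1) by exact: filterI.
have := near_parallelogram (c *: v) w dD'.
move: (fw _ e20); apply: filterS2 => h fwh Hpar.
have tle (t : R) : 0 <= t <= 1 -> `|t * h| <= `|h|.
  by move=> /andP[t0 t1]; rewrite normrM ger0_norm// ler_piMl.
have fD t : 0 <= t <= 1 -> derivable f (t *: (h *: (c *: v)) + (h *: w + x)) v.
  by move=> /tle th; rewrite scalerA; case: (Hpar _ _ th (lexx _)).
have [|t t01] := @mean_value_dir f (h *: w + x) (h *: (c *: v)).
  by move=> t /fD Dt; do 2 apply: derivable_scale_dir.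
have t01' : 0 <= t <= 1 by case/andP: t01 => /ltW -> /ltW ->.
have [_] := Hpar _ _ (tle _ t01') (lexx _); rewrite -scalerA.
have Dt := fD _ t01'.
rewrite (derive_scale_dir h (derivable_scale_dir (c := c) Dt)).
rewrite (derive_scale_dir c Dt).
set D := 'D_v f (_ + _) => Dle fE.
have -> : h *: (c *: v + w) + x = h *: (c *: v) + (h *: w + x).
  by rewrite scalerDr addrA.
have -> : f (h *: (c *: v) + (h *: w + x)) - f x - h * (c * 'D_v f x + a) =
    h * c * (D - 'D_v f x) + (f (h *: w + x) - f x - h * a).
  by move/eqP : fE; rewrite subr_eq => /eqP ->; ring.
rewrite (le_trans (ler_normD _ _))// [e]splitr mulrDl lerD//.
rewrite 2!normrM -mulrA mulrC ler_wpM2r// distrC.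
apply: le_trans (ler_wpM2l (normr_ge0 c) Dle) _.
by rewrite mulrCA ger_pMr// ler_pdivrMr ?mul1r ?lerDl.
Qed.

Lemma is_derive_translate f x v a : derivable f (a + x) v ->
  is_derive x v (fun z => f (a + z)) ('D_v f (a + x)).
Proof.
move=> /derivableP/is_deriveP fD; apply/is_deriveP => e /fD.
by apply: filterS => h; rewrite addrCA.
Qed.

(** Mean value theorem applied twice: along h v to z |-> f (h w + z) - f z, then
    along h w to D_v f. *)
Lemma second_difference f x v w (P : V -> Prop) :
  (\forall y \near x, derivable f y v) ->
  (\forall y \near x, derivable ('D_v f) y w) ->
  (\forall y \near x, P y) ->
  \forall h \near (0 : R), exists2 y, P y &
    f (h *: w + (h *: v + x)) - f (h *: v + x) - (f (h *: w + x) - f x)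
    = h * (h * 'D_w ('D_v f) y).
Proof.
move=> fD fDD Px.
have nP : \forall y \near x,
    [/\ derivable f y v, derivable ('D_v f) y w & P y].
  by move: fD fDD Px; apply: filterS3 => y A B C; exact: And3 A B C.
have := near_parallelogram w v nP; apply: filterS => h Hpar.
have tle (t : R) : 0 <= t <= 1 -> `|t * h| <= `|h|.
  by move=> /andP[t0 t1]; rewrite normrM ger0_norm// ler_piMl.
have ltW2 (t : R) : 0 < t < 1 -> 0 <= t <= 1.
  by move=> /andP[/ltW -> /ltW ->].
pose g z := f (h *: w + z) - f z.
have gD (t : R) : 0 <= t <= 1 -> is_derive (t *: (h *: v) + x) v g
    ('D_v f (h *: w + (t *: (h *: v) + x)) - 'D_v f (t *: (h *: v) + x)).
  move=> t01; apply: is_deriveB.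
    apply: is_derive_translate; rewrite scalerA.
    by have [Dz _ _] := Hpar _ _ (lexx _) (tle _ t01); exact: Dz.
  apply/derivableP; rewrite scalerA -[_ + x]add0r -(scale0r w).
  have h0 : `|0 : R| <= `|h| by rewrite normr0.
  by have [Dz _ _] := Hpar _ _ h0 (tle _ t01); exact: Dz.
have [t /gD [gt _]|t t01] := @mean_value_dir g x (h *: v).
  exact: derivable_scale_dir.
have /gD [gt gtE] := ltW2 _ t01.
rewrite (derive_scale_dir h gt) gtE /g => gE.
set z := t *: (h *: v) + x in gt gtE gE.
have zD (s : R) : 0 <= s <= 1 -> derivable ('D_v f) (s *: (h *: w) + z) w.
  move=> s01; rewrite /z !scalerA.
  by have [_ Dz _] := Hpar _ _ (tle _ s01) (tle _ (ltW2 _ t01)); exact: Dz.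
have [s /zD|s s01 sE] := @mean_value_dir ('D_v f) z (h *: w).
  exact: derivable_scale_dir.
exists (s *: (h *: w) + z).
  rewrite /z !scalerA.
  by case: (Hpar _ _ (tle _ (ltW2 _ s01)) (tle _ (ltW2 _ t01))).
by rewrite gE sE (derive_scale_dir h (zD _ (ltW2 _ s01))).
Qed.

(** Schwarz's theorem. The second difference of f over a small parallelogram is
    symmetric in v and w, and equals h^2 times a value near x of either mixed
    derivative. *)
Lemma derive_comm f x v w :
  (\forall y \near x, derivable f y v) ->
  (\forall y \near x, derivable f y w) ->
  (\forall y \near x, derivable ('D_v f) y w) ->
  (\forall y \near x, derivable ('D_w f) y v) ->
  {for x, continuous ('D_w ('D_v f))} -> {for x, continuous ('D_v ('D_w f))} ->
  'D_w ('D_v f) x = 'D_v ('D_w f) x.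
Proof.
move=> fv fw fvw fwv /cvgrPdist_lt cvw /cvgrPdist_lt cwv.
apply/eqP; rewrite -subr_eq0; apply/negPn/negP; rewrite -normr_gt0 => d0.
set d := `|_| in d0.
have d20 : 0 < d / 2 by rewrite divr_gt0.
have := second_difference fw fwv (cwv _ d20).
have := second_difference fv fvw (cvw _ d20).
move=> Hvw Hwv.
have : \forall h \near (0 : R)^', [/\ h != 0,
    (exists2 y, `|'D_w ('D_v f) x - 'D_w ('D_v f) y| < d / 2 &
      f (h *: w + (h *: v + x)) - f (h *: v + x) - (f (h *: w + x) - f x) =
      h * (h * 'D_w ('D_v f) y)) &
    (exists2 y, `|'D_v ('D_w f) x - 'D_v ('D_w f) y| < d / 2 &
      f (h *: v + (h *: w + x)) - f (h *: w + x) - (f (h *: v + x) - f x) =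
      h * (h * 'D_v ('D_w f) y))].
  rewrite near_withinE; move: Hvw Hwv; apply: filterS2 => h A B h0.
  exact: And3 h0 A B.
move=> /filter_ex[h [h0 [y1 y1d y1E] [y2 y2d y2E]]].
have swap (a b c e : R) : a - b - (c - e) = a - c - (b - e) by ring.
rewrite addrCA in y2E.
have y12 : 'D_v ('D_w f) y2 = 'D_w ('D_v f) y1.
  apply: (mulfI h0); apply: (mulfI h0).
  exact: etrans (esym y2E) (etrans (swap _ _ _ _) y1E).
have close (a b c : R) : `|a - c| < d / 2 -> `|b - c| < d / 2 -> `|a - b| < d.
  move=> ac bc; rewrite [ltRHS]splitr; apply: le_lt_trans (ltrD ac bc).
  by rewrite [`|b - c|]distrC ler_distD.
rewrite y12 in y2d.
have := close _ _ _ y1d y2d.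
by rewrite ltxx.
Qed.

(** If D_v (D_v f) x were positive, D_v f would be positive on a short segment
    after x, and the mean value theorem would make f increase along it. *)
Lemma second_derivative_test f x v :
  (\forall y \near x, derivable f y v) -> derivable ('D_v f) x v ->
  (\forall t \near (0 : R), f (t *: v + x) <= f x) ->
  'D_v f x = 0 /\ 'D_v ('D_v f) x <= 0.
Proof.
move=> fD fDD fmax.
have fDl := near_line v fD.
have fx0 : 'D_v f x = 0.
  have : \forall h \near (0 : R),
      derivable f (h *: v + x) v /\ f (h *: v + x) <= f x by exact: filterI.
  move=> /nbhs_ballP[r /= r0 rP].
  have inr t : t \in `](- r), r[%R -> ball (0 : R) r t.
    by rewrite in_itv/= -ball_normE /= sub0r normrN ltr_norml.
  have := @derive1_at_max R (fun s => f (s *: v + x)) (- r) r 0.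
  case=> [||||_ D0].
  - by rewrite (le_trans (_ : _ <= 0))// ?oppr_le0 ltW.
  - by move=> t /inr/rP[/is_derive_line[]].
  - by rewrite in_itv/= oppr_lt0 r0.
  - by move=> t /inr/rP[_]; rewrite scale0r add0r.
  have [f0 _] := rP _ (ballxx _ r0).
  have [_ E] := is_derive_line f0.
  by move: E; rewrite D0 scale0r add0r.
split=> //; rewrite leNgt; apply/negP => d0.
set d := 'D_v ('D_v f) x in d0.
have d20 : 0 < d / 2 by rewrite divr_gt0.
have /is_deriveP/(_ _ d20) fD2 := derivableP fDD.
have : \forall h \near (0 : R), [/\ derivable f (h *: v + x) v,
    f (h *: v + x) <= f x & `|'D_v f (h *: v + x) - h * d| <= d / 2 * `|h|].
  move: fDl fmax fD2; apply: filterS3 => h h1 h2; rewrite fx0 subr0 => h3.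
  by split.
move=> /nbhs_ballP[r /= r0 rP].
have r20 : 0 < r / 2 by rewrite divr_gt0.
have inr t : 0 <= t <= 1 -> ball (0 : R) r (t * (r / 2)).
  move=> /andP[t0 t1]; rewrite -ball_normE /= sub0r normrN ger0_norm.
    rewrite (le_lt_trans (ler_piMl _ t1)) ?ltW//.
    by rewrite ltr_pdivrMr// ltr_pMr// ltr1n.
  by rewrite mulr_ge0// ltW.
have fDr t : 0 <= t <= 1 -> derivable f (t *: ((r / 2) *: v) + x) v.
  by rewrite scalerA => /inr/rP[].
have [t /fDr Dt|t t01 fE] := @mean_value_dir f x ((r / 2) *: v).
  exact: derivable_scale_dir.
have t01' : 0 <= t <= 1 by case/andP: t01 => /ltW -> /ltW ->.
have tr0 : 0 < t * (r / 2) by case/andP: t01 => t0 _; rewrite mulr_gt0.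
have [_ _] := rP _ (inr _ t01').
have le1 : 0 <= (1 : R) <= 1 by rewrite ler01 lexx.
have [_ + _] := rP _ (inr _ le1); rewrite mul1r -subr_le0 fE.
rewrite (derive_scale_dir (r / 2) (fDr _ t01')) pmulr_rle0// scalerA => D0.
rewrite (gtr0_norm tr0) ler_norml => /andP[+ _].
rewrite lerBrDl => /le_trans/(_ D0).
by rewrite leNgt [_ * d]mulrC -mulNr -mulrDl mulr_gt0//; lra.
Qed.

End DirectionalDerivatives.

Lemma is_derive_partials {R : realType} {n : nat} (f : 'rV[R]_n -> R) x v :
  (forall i, \forall y \near x, derivable f y (unit_vec R i)) ->
  (forall i, {for x, continuous ('D_(unit_vec R i) f)}) ->
  is_derive x v f (\sum_i v 0 i * 'D_(unit_vec R i) f x).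
Proof.
move=> fD fC; rewrite {1}[v]row_sum_delta; elim: (index_enum _) => [|i r IH].
  by rewrite !big_nil; exact: is_derive0.
rewrite !big_cons; exact: (is_derive_add_dir (v 0 i) (fD i) (fC i) IH).
Qed.

(** * Gradient and Hessian of a smooth function *)

Section SmoothFunctions.
Context {R : realType} {n : nat}.
Implicit Types (f : 'rV[R]_n -> R) (x v : 'rV[R]_n) (U : set 'rV[R]_n).

Lemma smooth_is_derive U f (s : seq 'I_n) x v :
  open U -> smooth_on U f -> U x ->
  is_derive x v (partials s f) (\sum_i v 0 i * partials (i :: s) f x).
Proof.
move=> oU fU Ux; apply: is_derive_partials => i.
  have /nbhs_interior : nbhs x U by exact: open_nbhs_nbhs.
  apply: filterS => y /nbhs_singleton Uy.
  by have [_ fy] := fU s _ Uy; exact: fy.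
by have [fx _] := fU (i :: s) _ Ux; exact: fx.
Qed.

Lemma hessian_sym U f x : open U -> smooth_on U f -> U x ->
  (hessian f x)^T = hessian f x.
Proof.
move=> oU fU Ux; apply/matrixP => i j; rewrite !mxE.
have nU : \forall y \near x, U y by exact: open_nbhs_nbhs.
have D s k : \forall y \near x, derivable (partials s f) y (unit_vec R k).
  by apply: filterS nU => y Uy; have [_ fy] := fU s _ Uy; exact: fy.
have C s : {for x, continuous (partials s f)} by have [fx _] := fU s _ Ux.
exact: (derive_comm (D [::] i) (D [::] j) (D [:: i] j) (D [:: j] i)
  (C [:: j; i]) (C [:: i; j])).
Qed.

(** D_v f coincides near x with the combination of the partial derivatives of f
    with coefficients v_i, which is differentiated term by term. *)
Lemma smooth_is_derive2 U f x v : open U -> smooth_on U f -> U x ->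
  is_derive x v ('D_v f) (dot v (v *m hessian f x)).
Proof.
move=> oU fU Ux.
have nU : \forall y \near x, U y by exact: open_nbhs_nbhs.
have E : \forall y \near x,
    \sum_(i < n) (v 0 i *: partials [:: i] f) y = 'D_v f y.
  apply: filterS nU => y Uy.
  by have [_ ->] := smooth_is_derive [::] v oU fU Uy.
have : is_derive x v (\sum_(i < n) (v 0 i *: partials [:: i] f))
    (\sum_(i < n) v 0 i *: (\sum_j v 0 j * partials [:: j; i] f x)).
  apply: is_derive_sum => i; apply: is_deriveZ.
  exact: (smooth_is_derive [:: i] v oU fU Ux).
have -> : dot v (v *m hessian f x) =
   \sum_(i < n) v 0 i *: (\sum_j v 0 j * partials [:: j; i] f x).
  apply: eq_bigr => i _; rewrite mxE; congr (_ * _).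
  by apply: eq_bigr => j _; rewrite mxE.
apply: near_eq_is_derive.
by apply: filterS E => y; rewrite fct_sumE.
Qed.

Lemma hessian_at_max U f x v : open U -> smooth_on U f -> U x ->
  (\forall t \near (0 : R), f (t *: v + x) <= f x) ->
  dot v (grad f x) = 0 /\ dot v (v *m hessian f x) <= 0.
Proof.
move=> oU fU Ux fmax.
have nU : \forall y \near x, U y by exact: open_nbhs_nbhs.
have [fD fDE] := smooth_is_derive2 v oU fU Ux.
have [|] := second_derivative_test _ fD fmax.
  apply: filterS nU => y Uy.
  by have [fy _] := smooth_is_derive [::] v oU fU Uy; exact: fy.
rewrite fDE; have [_ ->] := smooth_is_derive [::] v oU fU Ux.
by move=> <- ?; split=> //; apply: eq_bigr => i _; rewrite mxE.
Qed.

End SmoothFunctions.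

(** * Minimizing a quadratic form under a linear constraint *)

Section Rayleigh.
Context {R : realType} {n : nat}.
Implicit Types (v w g x y : 'rV[R]_n) (H : 'M[R]_n).

(** Lets the inner product inherit bilinearity from the matrix product. *)
Lemma dotE v w : dot v w = (v *m w^T) 0 0.
Proof. by rewrite mxE; apply: eq_bigr => i _; rewrite mxE. Qed.

Lemma dotC v w : dot v w = dot w v.
Proof. by apply: eq_bigr => i _; rewrite mulrC. Qed.

Lemma dot0l v : dot 0 v = 0.
Proof. by rewrite dotE mul0mx mxE. Qed.

Lemma dotDl v w x : dot (v + w) x = dot v x + dot w x.
Proof. by rewrite !dotE mulmxDl mxE. Qed.

Lemma dotZl a v x : dot (a *: v) x = a * dot v x.
Proof. by rewrite !dotE -scalemxAl mxE. Qed.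

Lemma dotDr v w x : dot x (v + w) = dot x v + dot x w.
Proof. by rewrite dotC dotDl !(dotC x). Qed.

Lemma dotZr a v x : dot x (a *: v) = a * dot x v.
Proof. by rewrite dotC dotZl (dotC x). Qed.

Lemma dot_ge0 v : 0 <= dot v v.
Proof. by apply: sumr_ge0 => i _; rewrite -expr2 sqr_ge0. Qed.

Lemma dot_eq0 v : (dot v v == 0) = (v == 0).
Proof.
apply/eqP/eqP => [|->]; last by rewrite dotE mul0mx mxE.
move=> /eqP; rewrite psumr_eq0 => [/allP v0|i _]; last first.
  by rewrite -expr2 sqr_ge0.
apply/rowP => i; rewrite mxE; apply/eqP.
by have := v0 i (mem_index_enum _); rewrite mulf_eq0 orbb.
Qed.

Lemma dot_gt0 v : (0 < dot v v) = (v != 0).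
Proof. by rewrite lt_def dot_ge0 andbT dot_eq0. Qed.

Lemma dot_symmetric H v w : H^T = H -> dot (v *m H) w = dot v (w *m H).
Proof. by move=> Hs; rewrite !dotE trmx_mul Hs mulmxA. Qed.

Lemma dot_continuous (a b : 'rV[R]_n -> 'rV[R]_n) :
  (forall i, continuous (fun x => a x 0 i)) ->
  (forall i, continuous (fun x => b x 0 i)) ->
  continuous (fun x => dot (a x) (b x)).
Proof.
move=> ca cb; apply: (@continuous_big R _ +%R 0 xpredT add_continuous _ _
  (fun i x => a x 0 i * b x 0 i)) => i _ x.
exact: (cvgM (ca i x) (cb i x)).
Qed.

Lemma tangent_sphere_compact g : compact [set w | dot w w = 1 /\ dot w g = 0].
Proof.
have cid i : continuous (fun w : 'rV[R]_n => w 0 i) by exact: coord_continuous.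
apply: bounded_closed_compact.
  exists 1; split=> [|M M1 w [w1 _]]; first exact: num_real.
  rewrite /= [leLHS]mx_normrE; apply/bigmax_leP; split=> [|[i j] _ /=].
    by rewrite (le_trans ler01) ?ltW.
  rewrite (ord1 i); apply: le_trans (ltW M1).
  rewrite -(@expr_le1 _ 2)// real_normK ?num_real// -w1 expr2.
  by rewrite /dot (bigD1 j)//= lerDl sumr_ge0// => k _; rewrite -expr2 sqr_ge0.
have closed_dot (a b : 'rV[R]_n -> 'rV[R]_n) (c : R) :
    (forall i, continuous (fun x => a x 0 i)) ->
    (forall i, continuous (fun x => b x 0 i)) ->
    closed [set x | dot (a x) (b x) = c].
  move=> ca cb; apply: (@preimage_closed _ _ _ [set c]) => [x _|].
    exact: dot_continuous.
  exact: closed_eq.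
apply: closedI; apply: closed_dot => // i.
exact: cst_continuous.
Qed.

(** The inequality on the unit sphere extends to the whole hyperplane by
    homogeneity. *)
Lemma constrained_minimizer H g v : v != 0 -> dot v g = 0 ->
  exists w, [/\ dot w w = 1, dot w g = 0 &
    forall y, dot y g = 0 -> dot w (w *m H) * dot y y <= dot y (y *m H)].
Proof.
move=> v0 vg.
have K0 : [set w | dot w w = 1 /\ dot w g = 0] !=set0.
  exists ((Num.sqrt (dot v v))^-1 *: v); split; last by rewrite dotZl vg mulr0.
  rewrite dotZl dotZr mulrA -invfM -expr2 sqr_sqrtr ?dot_ge0//.
  by rewrite mulVf// dot_eq0.
have cq : continuous (fun w : 'rV[R]_n => dot w (w *m H)).
  apply: dot_continuous => i; first exact: coord_continuous.
  have -> : (fun x : 'rV[R]_n => (x *m H) 0 i) = (fun x => dot x (col i H)^T).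
    by apply/funext => x; rewrite mxE; apply: eq_bigr => j _; rewrite !mxE.
  apply: dot_continuous => j; first exact: coord_continuous.
  exact: cst_continuous.
have [|w] := EVT_min_rV K0 (@tangent_sphere_compact g)
  (_ : {within _, continuous (fun w => dot w (w *m H))}).
  exact: continuous_subspaceT.
rewrite inE => -[w1 wg] wmin; exists w; split=> // y yg.
have [->|y0] := eqVneq y 0; first by rewrite !dot0l mulr0.
have dy0 : 0 < dot y y by rewrite dot_gt0.
pose c := (Num.sqrt (dot y y))^-1.
have cc : c * c = (dot y y)^-1 by rewrite -invfM -expr2 sqr_sqrtr ?dot_ge0.
have /wmin : c *: y \in [set w | dot w w = 1 /\ dot w g = 0].
  rewrite inE; split; last by rewrite dotZl yg mulr0.
  by rewrite dotZl dotZr mulrA cc mulVf ?dot_eq0.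
by rewrite -scalemxAl dotZl dotZr mulrA cc mulrC ler_pdivlMr.
Qed.

(** Lagrange multiplier rule for the Rayleigh quotient on the hyperplane
    orthogonal to g. With w a minimizer and m the minimum, first-order optimality
    says that w H - m w is orthogonal to that hyperplane, hence a multiple
    of g; and m is nonpositive as soon as the form is nonpositive somewhere. *)
Lemma constrained_eigenvector H g v : H^T = H -> v != 0 -> dot v g = 0 ->
  dot v (v *m H) <= 0 ->
  exists w m l, [/\ w != 0, dot w g = 0, m <= 0 & w *m H = m *: w + l *: g].
Proof.
move=> Hs v0 vg Hv.
have [w [w1 wg wmin]] := constrained_minimizer H v0 vg.
set m := dot w (w *m H) in wmin.
have wn0 : w != 0 by rewrite -dot_gt0 w1.
pose D := w *m H - m *: w.
(* Let q be the quadratic form of H. As a function of s, the expression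
   q (w + s y) - m |w + s y|^2 is a nonnegative quadratic polynomial with zero
   constant term, so its linear coefficient vanishes. *)
have Dperp y : dot y g = 0 -> dot D y = 0.
  move=> yg; pose b := dot D y; pose a := dot y (y *m H) - m * dot y y.
  have a0 : 0 <= a by rewrite subr_ge0 wmin.
  have wyE s : dot (w + s *: y) ((w + s *: y) *m H)
      - m * dot (w + s *: y) (w + s *: y) = s * b *+ 2 + s ^+ 2 * a.
    rewrite /a /b /D -[- (m *: w)]scaleNr mulmxDl -scalemxAl.
    rewrite !(dotDl, dotDr, dotZl, dotZr) w1 -/m (dotC y w) (dotC y (w *m H)).
    rewrite -(dot_symmetric w y Hs).
    ring.
  have sP s : 0 <= s * b *+ 2 + s ^+ 2 * a.
    by rewrite -wyE subr_ge0 wmin// dotDl dotZl wg yg mulr0 addr0.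
  have a1 : 0 < a + 1 by rewrite ltr_wpDl.
  (* Stands in for the minimizer -b / a, which is undefined for a = 0. *)
  have := sP (- b / (a + 1)).
  have -> : - b / (a + 1) * b *+ 2 + (- b / (a + 1)) ^+ 2 * a
    = - (b ^+ 2 * ((a + 2) / (a + 1) ^+ 2)) by field; rewrite gt_eqF.
  rewrite oppr_ge0 pmulr_lle0 ?divr_gt0 ?exprn_gt0 ?ltr_wpDl// => b0.
  by apply/eqP; rewrite -sqrf_eq0 eq_le b0 sqr_ge0.
pose l := dot D g / dot g g.
exists w, m, l; split=> //.
  have : m * dot v v <= 0 by exact: le_trans (wmin _ vg) Hv.
  by rewrite pmulr_lle0// dot_gt0.
pose E := D - l *: g.
have Eg : dot E g = 0.
  rewrite dotDl -scaleNr dotZl mulNr /l.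
  have [->|g0] := eqVneq g 0.
    by rewrite ![dot _ 0]dotC !dot0l mulr0 subr0.
  by rewrite divfK ?subrr// dot_eq0.
apply/eqP; rewrite -subr_eq0 opprD addrA -/D -/E -dot_eq0.
by rewrite {1}/E dotDl Dperp// add0r -scaleNr dotZl dotC Eg mulr0.
Qed.

End Rayleigh.

(** * Principal curvatures and the Hessian of a defining function *)

Section Weingarten.
Context {R : realType} {n : nat}.
Implicit Types (Omega U : set 'rV[R]_n) (rho : 'rV[R]_n -> R).
Implicit Types (p v w : 'rV[R]_n).

Lemma is_derive_dot (a b : 'rV[R]_n -> 'rV[R]_n) p v (da db : 'rV[R]_n) :
  (forall i, is_derive p v (fun x => a x 0 i) (da 0 i)) ->
  (forall i, is_derive p v (fun x => b x 0 i) (db 0 i)) ->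
  is_derive p v (fun x => dot (a x) (b x)) (dot (a p) db + dot (b p) da).
Proof.
move=> ap bp.
have := is_derive_sum (fun i => is_deriveM (ap i) (bp i)).
rewrite big_split/=; set f := (X in is_derive _ _ X _).
have -> // : f = (fun x => dot (a x) (b x)).
by apply/funext => x; rewrite /f fct_sumE.
Qed.

Lemma derivable_sqrt (f : 'rV[R]_n -> R) p v : 0 < f p -> derivable f p v ->
  derivable (fun x => Num.sqrt (f x)) p v.
Proof.
move=> f0 /derivable1P fD; apply/derivable1P.
have phi0 : 0 < f (0 *: v + p) by rewrite scale0r add0r.
have [/derivable1_diffP sD _] := is_derive1_sqrt phi0.
apply/derivable1_diffP.
by move/derivable1_diffP : fD => /differentiable_comp; apply.
Qed.

(** The derivative of the normal along w is (m / |grad rho|) w plus a multiple of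
    grad rho. The multiple vanishes since the normal field has constant length,
    so that its derivative is orthogonal to it. *)
Lemma derive_outer_normal U rho p w m l : open U -> smooth_on U rho -> U p ->
  (forall x, U x -> grad rho x != 0) -> dot w (grad rho p) = 0 ->
  w *m hessian rho p = m *: w + l *: grad rho p ->
  'D_w (outer_normal rho) p = (m / euclid_norm (grad rho p)) *: w.
Proof.
move=> oU rhoU Up g0 wg wH.
pose g := grad rho; pose N x := (euclid_norm (g x))^-1.
have gD i : is_derive p w (fun x => g x 0 i) ((w *m hessian rho p) 0 i).
  have -> : (fun x => g x 0 i) = partials [:: i] rho.
    by apply/funext => x; rewrite mxE.
  rewrite mxE; under eq_bigr do rewrite mxE.
  exact: (smooth_is_derive [:: i] w oU rhoU Up).
have gpos x : U x -> 0 < euclid_norm (g x).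
  by move=> /g0 gx; rewrite sqrtr_gt0 dot_gt0.
have ND : derivable N p w.
  apply: derivableV; first by rewrite gt_eqF// gpos.
  apply: derivable_sqrt; first by rewrite dot_gt0 g0.
  by have [] := is_derive_dot gD gD.
pose c := 'D_w N p.
have nuD i : is_derive p w (fun x => outer_normal rho x 0 i)
    ((N p *: (w *m hessian rho p) + c *: g p) 0 i).
  have -> : (fun x => outer_normal rho x 0 i) = N * (fun x => g x 0 i).
    by apply/funext => x; rewrite mxE.
  have -> : (N p *: (w *m hessian rho p) + c *: g p) 0 i =
    N p *: (w *m hessian rho p) 0 i + g p 0 i *: c.
    by rewrite !mxE [c * _]mulrC.
  exact: (is_deriveM (derivableP ND) (gD i)).
set D := N p *: (w *m hessian rho p) + c *: g p in nuD.
have nu1 : \forall x \near p, dot (outer_normal rho x) (outer_normal rho x) = 1.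
  have : \forall x \near p, U x by exact: open_nbhs_nbhs.
  apply: filterS => x Ux.
  rewrite dotZl dotZr mulrA -invfM -expr2 sqr_sqrtr ?dot_ge0//.
  by rewrite mulVf// dot_eq0 g0.
have nuDnu : dot (outer_normal rho p) D = 0.
  have [_] := is_derive_dot nuD nuD.
  rewrite (near_eq_derive w nu1) derive_cst => /esym/eqP.
  by rewrite -mulr2n mulrn_eq0/= => /eqP.
have -> : 'D_w (outer_normal rho) p = D.
  rewrite derive_mx; last first.
    by apply/derivable_mxP => i j; rewrite (ord1 i); have [] := nuD j.
  by apply/rowP => j; rewrite mxE; have [_ ->] := nuD j.
have DE : D = (N p * m) *: w + (N p * l + c) *: g p.
  by rewrite /D wH scalerDr !scalerA [in RHS]scalerDl addrA.
have Np0 : N p != 0 by rewrite invr_eq0 gt_eqF// gpos.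
move: nuDnu; rewrite DE dotZl dotDr !dotZr (dotC _ w) wg mulr0 add0r => /eqP.
rewrite !mulf_eq0 (negPf Np0)/= dot_eq0 (negPf (g0 _ Up)) orbF => /eqP ->.
by rewrite scale0r addr0 mulrC.
Qed.

(** Otherwise the minimum m of the Hessian on unit tangent vectors is nonpositive,
    and m / |grad rho| is a principal curvature, against the positive lower
    bound. *)
Lemma boundary_hessian_pos Omega p U rho v : uniformly_convex Omega ->
  boundary Omega p -> local_defining_function Omega p U rho ->
  v != 0 -> dot v (grad rho p) = 0 -> 0 < dot v (v *m hessian rho p).
Proof.
move=> [k0 k0_gt0 curv] bp ldf v0 vg; rewrite ltNge; apply/negP => Hv.
have [oU Up rhoU g0 _] := ldf.
have [w [m [l [w0 wg m0 wH]]]] :=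
  constrained_eigenvector (hessian_sym oU rhoU Up) v0 vg Hv.
have /(curv _ _ bp) :
    principal_curvature Omega p (m / euclid_norm (grad rho p)).
  exists U, rho; split=> //; exists w; split=> //.
    by rewrite dotZr wg mulr0.
  exact: (derive_outer_normal oU rhoU Up g0 wg wH).
rewrite leNgt => /negP; apply; apply: le_lt_trans k0_gt0.
by rewrite mulr_le0_ge0// invr_ge0 sqrtr_ge0.
Qed.

End Weingarten.

(** * Uniformly convex domains are convex *)

Section Segments.
Context {R : realType} {V : normedModType R}.

Lemma segment_continuous (x : V) :
  continuous (fun tz : R * V => tz.1 *: (tz.2 - x) + x).
Proof.
move=> tz; apply: cvgD; last exact: cvg_cst.
apply: cvgZ; first exact: cvg_fst.
by apply: cvgB; [exact: cvg_snd|exact: cvg_cst].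
Qed.

Lemma homothety_continuous (x : V) (t : R) :
  continuous (fun z : V => t *: (z - x) + x).
Proof.
move=> z; apply: cvgD; last exact: cvg_cst.
apply: cvgZ; first exact: cvg_cst.
by apply: cvgB; [exact: cvg_id|exact: cvg_cst].
Qed.

End Segments.

Section Convexity.
Context {R : realType} {n : nat}.
Implicit Types (Omega U : set 'rV[R]_n) (rho : 'rV[R]_n -> R).
Implicit Types (p q x y : 'rV[R]_n).

Lemma defining_function_closure Omega p U rho q :
  local_defining_function Omega p U rho -> U q -> closure Omega q -> rho q <= 0.
Proof.
move=> [oU Up rhoU g0 Orho] Uq cq; rewrite leNgt; apply/negP => rq.
have [rc _] := rhoU [::] _ Uq.
have nU : \forall z \near q, U z by exact: open_nbhs_nbhs.
have nr : \forall z \near q, 0 < rho z.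
  by move/cvgr_gt : (rc : rho @ q --> rho q); exact.
have [z [Oz [Uz rz]]] := cq _ (filterI nU nr).
by move: Oz => /(Orho _ Uz) /(lt_trans rz); rewrite ltxx.
Qed.

(** At a boundary point of the segment, the defining function restricted to the
    segment has a local maximum, which the positive curvature excludes. *)
Lemma segment_interior Omega x y : open Omega -> smooth_boundary Omega ->
  uniformly_convex Omega -> Omega x -> Omega y ->
  (forall t : R, 0 <= t <= 1 -> closure Omega (t *: (y - x) + x)) ->
  forall t : R, 0 <= t <= 1 -> Omega (t *: (y - x) + x).
Proof.
move=> oO sO ucO Ox Oy cl t t01; apply: contrapT => nOz.
set z := t *: (y - x) + x in nOz.
have bz : boundary Omega z by split; [exact: cl|move/interior_subset].
have [U [rho ldf]] := sO _ bz.
have [oU Uz rhoU g0 Orho] := ldf.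
have t0 : 0 < t.
  rewrite lt_neqAle; case/andP: t01 => -> _; rewrite andbT.
  by apply/eqP => t0; apply: nOz; rewrite /z -t0 scale0r add0r.
have t1 : t < 1.
  rewrite lt_neqAle; case/andP: t01 => _ ->; rewrite andbT.
  by apply/eqP => t1; apply: nOz; rewrite /z t1 scale1r subrK.
have yx : y - x != 0.
  by apply/eqP => yx; apply: nOz; rewrite /z yx scaler0 add0r.
have rz : 0 <= rho z by rewrite leNgt; apply/negP => /(Orho _ Uz).
have zmax : \forall s \near (0 : R), rho (s *: (y - x) + z) <= rho z.
  have nUz : \forall q \near z, U q by exact: open_nbhs_nbhs.
  (* The segment goes on beyond z on both sides, as x and y are in Omega. *)
  have e0 : 0 < Num.min t (1 - t) by rewrite lt_min t0 subr_gt0.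
  have := @nbhs0_lt R R^o _ e0; move: (near_line (y - x) nUz).
  apply: filterS2 => s Us; rewrite lt_min => /andP[st s1].
  apply: le_trans rz; apply: (defining_function_closure ldf Us).
  rewrite /z addrA -scalerDl; apply: cl.
  move: st s1; rewrite !ltr_norml => /andP[s1 s2] /andP[s3 s4].
  by apply/andP; split; lra.
have [vg] := hessian_at_max oU rhoU Uz zmax.
by rewrite leNgt (boundary_hessian_pos ucO bz ldf yx vg).
Qed.

(** The points visible from x form a subset of Omega which is nonempty, open and
    closed in Omega. Openness is the tube lemma for the compact unit interval. *)
Lemma uniformly_convex_segment Omega x y :
  domain Omega -> smooth_boundary Omega -> uniformly_convex Omega ->
  Omega x -> Omega y -> forall t : R, 0 <= t <= 1 -> Omega (t *: (y - x) + x).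
Proof.
move=> [oO cO _] sO ucO Ox Oy.
pose B := [set y | forall t : R, 0 <= t <= 1 -> Omega (t *: (y - x) + x)].
have line1 z : 1 *: (z - x) + x = z by rewrite scale1r subrK.
have BO : B `<=` Omega.
  by move=> z Bz; rewrite -(line1 z); apply: Bz; rewrite ler01 lexx.
suff BE : B = Omega by have : B y by rewrite BE.
have cont := @segment_continuous _ _ x.
apply: cO.
- by exists x => t _; rewrite subrr scaler0 add0r.
- exists B; last by apply/seteqP; split=> [z Bz|z []//]; split=> //; exact: BO.
  rewrite openE => z Bz.
  have /compact_near_coveringP cov := @segment_compact R 0 1.
  have : \forall z' \near z,
      `[0, 1]%classic `<=` (fun t : R => Omega (t *: (z' - x) + x)).
    apply: (cov _ (nbhs z) (fun z' t => Omega (t *: (z' - x) + x))) => t /=.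
    rewrite in_itv/= => /Bz Ot.
    exact: (cont (t, z) _ (open_nbhs_nbhs (conj oO Ot))).
  by apply: filterS => z' Bz' t t01; apply: Bz'; rewrite /= in_itv/=.
- exists (closure B); first exact: closed_closure.
  apply/seteqP; split=> z.
    by move=> Bz; split; [exact: BO|exact: subset_closure].
  move=> [Oz cBz]; apply: segment_interior => // t t01 W.
  have ct := @homothety_continuous _ _ x t.
  move=> /(ct z) /cBz[z' [Bz' Wz']].
  by exists (t *: (z' - x) + x); split=> //; exact: Bz'.
Qed.

End Convexity.

(** * Negativity of admissible solutions *)

Section AdmissibleSolutions.
Context {R : realType} {n : nat}.
Implicit Types (Omega : set 'rV[R]_n.+1) (u : 'rV[R]_n.+1 -> R).

(** When the characteristic polynomial does not split, the default eigenvalues are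
    zero and so is sigma 1; a positive sigma 1 thus guarantees that the
    eigenvalues are genuine, and their sum is the trace. *)
Lemma sigma1_gt0_trace (A : 'M[R]_n.+1) : 0 < sigma 1 A -> 0 < \tr A.
Proof.
have -> : sigma 1 A = \sum_i eigenvalues A 0 i.
  rewrite /sigma (eq_bigl
    (fun I => I \in [set [set i] | i in [set: 'I_n.+1]]%SET)) => [|I].
    rewrite big_imset/=; last by move=> i j _ _ /set1_inj.
    by apply: eq_big => [i|i _]; rewrite ?inE// big_set1.
  by apply/cards1P/imsetP => [[i ->]|[i _ ->]]; exists i.
rewrite /eigenvalues; case: xgetP => [mu _ /= Amu|_]; last first.
  by rewrite big1 ?ltxx// => i _; rewrite mxE.
have := char_poly_trace A (ltn0Sn n).
rewrite Amu.
set s := [seq mu 0 i | i <- enum 'I_n.+1].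
have -> : \prod_(i < n.+1) ('X - (mu 0 i)%:P) = \prod_(a <- s) ('X - a%:P).
  by rewrite big_map big_enum.
have sz : size s = n.+1 by rewrite size_map size_enum_ord.
have := coefPn_prod_XsubC (ps := s); rewrite sz => /(_ isT) ->.
by rewrite big_map big_enum => /oppr_inj ->.
Qed.

(** At an interior maximum all diagonal second derivatives, hence the trace of the
    Hessian, would be nonpositive. *)
Lemma no_interior_max Omega u x : open Omega -> admissible_solution Omega u ->
  Omega x -> ~ (forall y, Omega y -> u y <= u x).
Proof.
move=> oO [[su _ _] _ _ G3] Ox umax.
have [_ /sigma1_gt0_trace + _ _] := G3 _ Ox; apply/negP; rewrite -leNgt.
apply: sumr_le0 => i _.
have [|_] := @hessian_at_max _ _ Omega u x (unit_vec R i) oO su Ox.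
  have nO : \forall y \near x, Omega y by exact: open_nbhs_nbhs.
  by apply: filterS (near_line (unit_vec R i) nO) => t /umax.
rewrite -rowE /dot (bigD1 i)//= big1 => [|j ji].
  by rewrite !mxE !eqxx mul1r addr0.
by rewrite !mxE eqxx (negPf ji) mul0r.
Qed.

(** A maximum point over the closure cannot lie in Omega, so the maximum is the
    boundary value 0; a point of Omega with value 0 would be an interior
    maximum. *)
Lemma admissible_solution_lt0 Omega u x : open Omega -> bounded_set Omega ->
  admissible_solution Omega u -> Omega x -> u x < 0.
Proof.
move=> oO bO sol Ox; have [[_ cu _] _ u0 _] := sol.
have ccl : compact (closure Omega).
  apply: bounded_closed_compact; last exact: closed_closure.
  have [M [Mr MO]] := bO; exists M; split=> // M' MM' q.
  have clM : closed [set q : 'rV[R]_n.+1 | `|q| <= M'].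
    apply: (@preimage_closed _ _ _ [set r : R | r <= M']) => [z _|].
      exact: norm_continuous.
    exact: closed_le.
  by move=> /(closureS (MO _ MM')); rewrite -(closure_id _).1.
have [|c] := EVT_max_rV _ ccl cu; first by exists x; exact: subset_closure.
rewrite inE => cc cmax.
have cmaxO y : Omega y -> u y <= u c.
  by move=> Oy; apply: cmax; rewrite inE; exact: subset_closure.
have nOc : ~ Omega c by move=> /(no_interior_max oO sol); apply.
have uc : u c = 0.
  by apply: u0; split=> // /interior_subset.
rewrite ltNge; apply/negP => ux0; apply: (no_interior_max oO sol Ox) => y Oy.
by apply: le_trans ux0; rewrite -uc cmaxO.
Qed.

End AdmissibleSolutions.

(** * Sublevel sets of convexifiable functions *)

Section QuasiConvexity.
Context {R : realType} {n : nat}.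
Implicit Types (Omega : set 'rV[R]_n) (u : 'rV[R]_n -> R).

(** The inequality Psi (u z) <= t Psi (u x) + (1 - t) Psi (u y) is impossible
    when u x < u z and u y < u z, since Psi is strictly increasing on the range
    of u. *)
Lemma convex_comp_sublevel Omega u (Psi : R -> R) (c : R) :
  (forall x y, Omega x -> Omega y ->
    forall t : R, 0 <= t <= 1 -> Omega (t *: (y - x) + x)) ->
  {in u @` Omega &, {homo Psi : s t / s < t}} ->
  @convex_function R 'rV[R]_n Omega (Psi \o u) ->
  @convex_set R 'rV[R]_n [set q | Omega q /\ u q < c].
Proof.
move=> cO Psi_incr cvx x y t; rewrite !inE => -[Ox uxc] [Oy uyc].
have zE : conv t x y = t%:num *: (x - y) + y :> 'rV[R]_n.
  have -> : conv t x y = t%:num *: x + (1 - t%:num) *: y :> 'rV[R]_n by [].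
  by rewrite scalerBl scale1r scalerBr addrA addrAC.
have Oz : Omega (conv t x y).
  by rewrite zE; apply: cO => //; rewrite ge0 le1.
split=> //.
have in_range q : Omega q -> u q \in u @` Omega.
  by move=> Oq; rewrite inE; exists q.
rewrite ltNge; apply/negP => cz.
have xz := Psi_incr _ _ (in_range _ Ox) (in_range _ Oz) (lt_le_trans uxc cz).
have yz := Psi_incr _ _ (in_range _ Oy) (in_range _ Oz) (lt_le_trans uyc cz).
have := cvx t x y; rewrite !inE => /(_ Ox Oy).
rewrite convRE /= => le.
have : t%:num * Psi (u x) + (1 - t%:num) * Psi (u y) < Psi (u (conv t x y)).
  have t0 : 0 <= t%:num :> R by [].
  have t1 : 0 <= 1 - t%:num :> R by rewrite subr_ge0.
  have E (a : R) : a = t%:num * a + (1 - t%:num) * a by ring.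
  rewrite [ltRHS]E.
  have [->|tn0] := eqVneq (t%:num : R) 0.
    by rewrite !mul0r !add0r subr0 !mul1r.
  apply: ltr_leD; first by rewrite ltr_pM2l// lt_neqAle eq_sym tn0.
  by rewrite ler_wpM2l// ltW.
by rewrite ltNge le.
Qed.

End QuasiConvexity.

Unset Implicit Arguments.

Theorem corollary1p7 (R : realType) (Omega : set 'rV[R]_4) (u : 'rV[R]_4 -> R)
  (Omega_domain : domain Omega)
  (Omega_bounded : bounded_set Omega)
  (Omega_smooth : smooth_boundary Omega)
  (Omega_convex : uniformly_convex Omega)
  (u_solution : admissible_solution Omega u)
  (sublevel_not_convex :
    ~ @convex_set R 'rV[R]_4 [set q | Omega q /\ u q < - (3%:R / 125%:R)]) :
  (forall Psi : R -> R,
     {in u @` Omega &, {homo Psi : s t / s < t}} ->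
     ~ @convex_function R 'rV[R]_4 Omega (Psi \o u)) /\
  (forall alpha : R, 0 < alpha ->
     ~ @convex_function R 'rV[R]_4 Omega (fun x => - ((- u x) `^ alpha))).
Proof.
have seg := fun x y => @uniformly_convex_segment _ _ _ x y Omega_domain
  Omega_smooth Omega_convex.
have Psi_not_convex (Psi : R -> R) :
    {in u @` Omega &, {homo Psi : s t / s < t}} ->
    ~ @convex_function R 'rV[R]_4 Omega (Psi \o u).
  move=> Psi_incr Psi_convex; apply: sublevel_not_convex.
  exact: convex_comp_sublevel seg Psi_incr Psi_convex.
split=> // alpha alpha0.
apply: (Psi_not_convex (fun s => - ((- s) `^ alpha))) => s t.
rewrite !inE => -[x Ox <-] [y Oy <-] uxy.
have [oO _ _] := Omega_domain.
have u0 z : Omega z -> u z < 0 :=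
  admissible_solution_lt0 oO Omega_bounded u_solution.
by rewrite ltrN2 gt0_ltr_powR// ?nnegrE ?oppr_ge0 ?ltW ?u0// ltrN2.
Qed.
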